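(* Let $\mathcal G$ be a Lie algebra and $r\in\wedge^2\mathcal G$ a unimodular solution of the classical Yang-Baxter equation. Let $\Gamma:\mathcal G\to\mathcal X(M)$ be a locally free action of $\mathcal G$ on a Riemannian manifold $(M,g)$ such that, for any $u\in\mathcal G$, $\Gamma(u)$ is a Killing vector field. Then $\pi:=\Gamma(r)$ is a Killing-Poisson tensor on $(M,g)$.
   Context: All objects are smooth; Lie algebras are real and finite-dimensional. For $r\in\wedge^2\mathcal G$, let also $r:\mathcal G^*\to\mathcal G$ denote the linear map $\alpha(r(\beta))=r(\alpha,\beta)$, and let $\mathrm{Im}\,r$ be its image. $r$ is a solution of the classical Yang-Baxter equation if $[r,r]=0$, where $[r,r](\alpha,\beta,\gamma)=\alpha([r(\beta),r(\gamma)])+\beta([r(\gamma),r(\alpha)])+\gamma([r(\alpha),r(\beta)])$ for $\alpha,\beta,\gamma\in\mathcal G^*$; in that case $\mathrm{Im}\,r$ is a Lie subalgebra. Such a solution is unimodular if for every $u\in\mathrm{Im}\,r$ the trace of $\mathrm{ad}_u:\mathrm{Im}\,r\to\mathrm{Im}\,r$, $v\mapsto[u,v]$, vanishes. An action of $\mathcal G$ on $M$ is a Lie algebra morphism $\Gamma:\mathcal G\to\mathcal X(M)$ into the vector fields on $M$; it is locally free if for every $x\in M$ the map $\mathcal G\to T_xM$, $u\mapsto\Gamma(u)(x)$, is injective. If $r=\sum_{i,j}a_{ij}u_i\wedge u_j$, then $\Gamma(r)=\sum_{i,j}a_{ij}\Gamma(u_i)\wedge\Gamma(u_j)$. A Poisson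 tensor is a bivector field $\pi$ with $[\pi,\pi]=0$ (Schouten-Nijenhuis bracket); its anchor is $\pi_\#:T^*M\to TM$, $\beta(\pi_\#(\alpha))=\pi(\alpha,\beta)$, and $f$ is a Casimir function if $\pi_\#(df)=0$. A Poisson tensor $\pi$ on $(M,g)$ is a Killing-Poisson tensor if (i) the divergence of $\pi$ with respect to the Levi-Civita connection $\nabla$ (the vector field obtained by contracting $\nabla\pi$) vanishes, and (ii) for any open set $U\subset M$ and any Casimir function $f\in C^\infty(U)$, $L_{\nabla f}\pi=0$, where $\nabla f$ is the gradient of $f$. *)

(* Defs.v *)
From HB Require Import structures.
From mathcomp Require Import all_boot all_order all_algebra.
From mathcomp Require Import all_classical all_reals all_analysis.

Set Implicit Arguments.
Unset Strict Implicit.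
Unset Printing Implicit Defensive.

Import Order.TTheory GRing.Theory Num.Theory.
Import numFieldNormedType.Exports.

Local Open Scope classical_set_scope.
Local Open Scope ring_scope.

(** * Lie algebras and the classical Yang-Baxter equation *)

Record lieAlgebra (R : realType) := LieAlgebra {
  lie_sort :> vectType R;
  lie : {bilinear lie_sort -> lie_sort -> lie_sort};
  lie_alt : forall u, lie u u = 0;
  lie_jacobi : forall u v w,
    lie u (lie v w) + lie v (lie w u) + lie w (lie u v) = 0 }.

Section YangBaxter.
Context {R : realType} {G : lieAlgebra R}.

Definition lie_dual : vectType R := 'Hom(G, R^o).

(* As G is finite-dimensional, the second exterior power of G is identified
   with the space of alternating bilinear forms on the dual of G. *)
Definition is_alternating (r : {biscalar lie_dual}) :=
  forall a : lie_dual, r a a = 0.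

Definition wedge2 (u v : G) (a b : lie_dual) : R := a u * b v - a v * b u.

Definition ebasis : (\dim {:G}).-tuple G := vbasis {:G}.

Definition ecobasis (i : 'I_(\dim {:G})) : lie_dual :=
  linfun (coord ebasis i : G -> R^o).

(* The linear map r : G^* -> G; sharpE below is the defining identity. *)
Definition sharp (r : {biscalar lie_dual}) (b : lie_dual) : G :=
  \sum_(i < \dim {:G}) r (ecobasis i) b *: ebasis`_i.

Lemma sharpE (r : {biscalar lie_dual}) (a b : lie_dual) :
  a (sharp r b) = r a b.
Proof.
have aE : a = \sum_(i < \dim {:G}) a ebasis`_i *: ecobasis i.
  apply/lfunP => v; rewrite sum_lfunE.
  rewrite [in LHS](coord_vbasis (memvf v)) linear_sum /=.
  apply: eq_bigr => i _; rewrite linearZ /= lfunE /= lfunE /=.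
  by rewrite /GRing.scale /= mulrC.
rewrite [in RHS]aE linear_sumlz /sharp linear_sum /=; apply: eq_bigr => i _.
by rewrite linearZl_LR linearZ /= /GRing.scale /= mulrC.
Qed.

Fact sharp_is_linear (r : {biscalar lie_dual}) : linear (sharp r).
Proof.
move=> k a b; rewrite /sharp scaler_sumr -big_split /=.
by apply: eq_bigr => i _; rewrite linearPr /= scalerDl scalerA.
Qed.

HB.instance Definition _ (r : {biscalar lie_dual}) :=
  GRing.isLinear.Build R lie_dual G _ (sharp r) (@sharp_is_linear r).

Definition im_sharp (r : {biscalar lie_dual}) : {vspace G} :=
  limg (linfun (sharp r)).

Lemma im_sharpP (r : {biscalar lie_dual}) (u : G) :
  reflect (exists b, u = sharp r b) (u \in im_sharp r).
Proof.
by apply: (iffP memv_imgP) => [[b _ ->]|[b ->]]; exists b;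
  rewrite ?memvf ?lfunE.
Qed.

(* r is the sum of the a_ij u_i /\ u_j. *)
Definition decomposition (r : {biscalar lie_dual}) (m : nat) (a : 'M[R]_m)
    (u : 'I_m -> G) := forall x y : lie_dual,
  r x y = \sum_(i < m) \sum_(j < m) a i j * wedge2 (u i) (u j) x y.

Definition cybe (r : {biscalar lie_dual}) := forall a b c : lie_dual,
  a (lie G (sharp r b) (sharp r c)) + b (lie G (sharp r c) (sharp r a))
  + c (lie G (sharp r a) (sharp r b)) = 0.

(* Trace of the endomorphism of W induced by ad_u, when ad_u preserves W. *)
Definition trace_ad_on (W : {vspace G}) (u : G) : R :=
  \tr (\matrix_(i < \dim W, j < \dim W)
         coord (vbasis W) j (lie G u (vbasis W)`_i)).

Definition unimodular (r : {biscalar lie_dual}) :=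
  forall u, u \in im_sharp r -> trace_ad_on (im_sharp r) u = 0.

End YangBaxter.

Arguments lie_dual {R} G.

(** * Smooth functions on open subsets of R^n *)

Section Euclidean.
Context {R : realType} {n : nat}.

Definition basisvec (i : 'I_n) : 'rV[R]_n := delta_mx 0 i.

(* For V open: iterated partial derivatives up to order k exist and are
   continuous on V. *)
Fixpoint Ck (k : nat) (V : set 'rV[R]_n) (f : 'rV[R]_n -> R) : Prop :=
  (forall x, V x -> {for x, continuous f}) /\
  if k is k'.+1 then
    forall i, (forall x, V x -> derivable f x (basisvec i)) /\
              Ck k' V (fun x => 'D_(basisvec i) f x)
  else True.

Definition smooth (V : set 'rV[R]_n) (f : 'rV[R]_n -> R) :=
  forall k, Ck k V f.

End Euclidean.

(** * Smooth manifolds *)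

(* A smooth atlas on a Hausdorff second countable space: [chart_map c] is a
   homeomorphism from the open set [chart_dom c] onto an open subset of R^n,
   with inverse [chart_inv c]; both functions are total, with irrelevant values
   outside [chart_dom c] and its image. *)
Record manifold (R : realType) (n : nat) := Manifold {
  msort :> topologicalType;
  chart : Type;
  chart_dom : chart -> set msort;
  chart_map : chart -> msort -> 'rV[R]_n;
  chart_inv : chart -> 'rV[R]_n -> msort;
  manifold_hausdorff : hausdorff_space msort;
  manifold_second_countable : @second_countable msort;
  dom_open : forall c, open (chart_dom c);
  dom_cover : forall p, exists c, chart_dom c p;
  image_open : forall c, open (chart_map c @` chart_dom c);
  chart_mapK : forall c p, chart_dom c p -> chart_inv c (chart_map c p) = p;
  chart_map_continuous : forall c p, chart_dom c p ->
    {for p, continuous (chart_map c)};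
  chart_inv_continuous : forall c y, (chart_map c @` chart_dom c) y ->
    {for y, continuous (chart_inv c)};
  transition_smooth : forall c d j,
    smooth (chart_map c @` (chart_dom c `&` chart_dom d))
           (fun y => chart_map d (chart_inv c y) 0 j) }.

Arguments chart_dom {R n M} c : rename.
Arguments chart_map {R n M} c p : rename.
Arguments chart_inv {R n M} c y : rename.

Section Tensors.
Context {R : realType} {n : nat} {M : manifold R n}.
Implicit Types (c d : chart M) (p : M) (U : set M) (i j k l : 'I_n).

Definition chart_smooth c U (h : M -> R) :=
  smooth (chart_map c @` (chart_dom c `&` U)) (h \o chart_inv c).

Definition smooth_fun U (f : M -> R) := forall c, chart_smooth c U f.

(* Partial derivative of h at p with respect to the i-th coordinate of c. *)
Definition partial c i (h : M -> R) p : R :=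
  'D_(basisvec i) (h \o chart_inv c) (chart_map c p).

(* Entry (i, j) is the derivative of the j-th coordinate of d with respect to
   the i-th coordinate of c. *)
Definition chart_jacobian c d p : 'M[R]_n :=
  \matrix_(i, j) partial c i (fun q => chart_map d q 0 j) p.

(* Tensor fields are given by their components in every chart, subject to the
   transformation law under changes of charts: [X c p] is the array of
   components at p with respect to c, and only matters when [chart_dom c p].
   In particular the tangent space at p is the space of families of rows
   indexed by the charts at p that obey this law. *)
Definition vfield := chart M -> M -> 'rV[R]_n.
Definition tensor2 := chart M -> M -> 'M[R]_n.

Implicit Types (X Y : vfield) (P Q g : tensor2).

Definition is_vector_field X :=
  (forall c j, chart_smooth c setT (fun p => X c p 0 j)) /\
  (forall c d p, chart_dom c p -> chart_dom d p ->
     X d p = X c p *m chart_jacobian c d p).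

Definition eq_at p X Y := forall c, chart_dom c p -> X c p = Y c p.

Definition eq_vfield X Y := forall p, eq_at p X Y.

Definition is_bivector_field P :=
  [/\ forall c i j, chart_smooth c setT (fun p => P c p i j),
      forall c p, chart_dom c p -> (P c p)^T = - P c p &
      forall c d p, chart_dom c p -> chart_dom d p ->
        P d p = (chart_jacobian c d p)^T *m P c p *m chart_jacobian c d p].

Definition is_riemannian_metric g :=
  [/\ forall c i j, chart_smooth c setT (fun p => g c p i j),
      forall c p, chart_dom c p -> (g c p)^T = g c p,
      forall c p (v : 'rV[R]_n), chart_dom c p -> v != 0 ->
        0 < (v *m g c p *m v^T) 0 0 &
      forall c d p, chart_dom c p -> chart_dom d p ->
        g c p = chart_jacobian c d p *m g d p *m (chart_jacobian c d p)^T].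

Definition vbracket X Y : vfield := fun c p =>
  \row_j \sum_i (X c p 0 i * partial c i (fun q => Y c q 0 j) p
                 - Y c p 0 i * partial c i (fun q => X c q 0 j) p).

Definition vwedge X Y : tensor2 := fun c p =>
  \matrix_(i, j) (X c p 0 i * Y c p 0 j - X c p 0 j * Y c p 0 i).

(* Component (i, j, k) of the Schouten-Nijenhuis bracket of two bivector
   fields, normalized so that
   [X /\ Y, Z /\ T] = [X, Z] /\ Y /\ T - [X, T] /\ Y /\ Z
                      - [Y, Z] /\ X /\ T + [Y, T] /\ X /\ Z. *)
Definition schouten P Q c p i j k : R :=
  let S a b e := \sum_l (Q c p e l * partial c l (fun q => P c q a b) p
                         + P c p e l * partial c l (fun q => Q c q a b) p) in
  S i j k + S j k i + S k i j.

Definition is_poisson P := is_bivector_field P /\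
  forall c p i j k, chart_dom c p -> schouten P P c p i j k = 0.

Definition differential (f : M -> R) c p : 'rV[R]_n := \row_i partial c i f p.

(* [anchor P a] is the vector with b (anchor P a) = P (a, b). *)
Definition anchor P c p (a : 'rV[R]_n) : 'rV[R]_n := a *m P c p.

Definition casimir P U (f : M -> R) := smooth_fun U f /\
  forall c p, chart_dom c p -> U p -> anchor P c p (differential f c p) = 0.

(** * Riemannian notions *)

(* Christoffel symbols: the component of index k of nabla_i (d/dx_j), for the
   Levi-Civita connection nabla of g. *)
Definition christoffel g c p i j k : R :=
  2^-1 * \sum_l invmx (g c p) k l *
    (partial c i (fun q => g c q j l) p + partial c j (fun q => g c q i l) p
     - partial c l (fun q => g c q i j) p).

(* Component (i, j) of nabla_k P. *)
Definition cov_deriv g P c p k i j : R :=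
  partial c k (fun q => P c q i j) p
  + \sum_l (christoffel g c p k l i * P c p l j
            + christoffel g c p k l j * P c p i l).

Definition divergence g P : vfield := fun c p =>
  \row_j \sum_i cov_deriv g P c p i i j.

Definition gradient g (f : M -> R) : vfield := fun c p =>
  differential f c p *m invmx (g c p).

(* Lie derivative of a covariant 2-tensor. *)
Definition lie_deriv_cov X g : tensor2 := fun c p =>
  \matrix_(i, j) \sum_k (X c p 0 k * partial c k (fun q => g c q i j) p
     + g c p k j * partial c i (fun q => X c q 0 k) p
     + g c p i k * partial c j (fun q => X c q 0 k) p).

(* Lie derivative of a contravariant 2-tensor. *)
Definition lie_deriv_contra X P : tensor2 := fun c p =>
  \matrix_(i, j) \sum_k (X c p 0 k * partial c k (fun q => P c q i j) p
     - P c p k j * partial c k (fun q => X c q 0 i) p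
     - P c p i k * partial c k (fun q => X c q 0 j) p).

Definition killing g X := is_vector_field X /\
  forall c p, chart_dom c p -> lie_deriv_cov X g c p = 0.

Definition killing_poisson g P :=
  [/\ is_poisson P,
      forall c p, chart_dom c p -> divergence g P c p = 0 &
      forall U f, open U -> casimir P U f ->
        forall c p, chart_dom c p -> U p ->
          lie_deriv_contra (gradient g f) P c p = 0].

(** * Actions of Lie algebras *)

Definition lie_action (G : lieAlgebra R) (A : G -> vfield) :=
  [/\ forall u, is_vector_field (A u),
      forall (k : R) u v,
        eq_vfield (A (k *: u + v)) (fun c p => k *: A u c p + A v c p) &
      forall u v, eq_vfield (A (lie G u v)) (vbracket (A u) (A v))].

Definition locally_free (G : lieAlgebra R) (A : G -> vfield) :=
  forall p u v, eq_at p (A u) (A v) -> u = v.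

(* The bivector field Gamma(r) for r the sum of the a_ij u_i /\ u_j. *)
Definition action_bivector (G : lieAlgebra R) (A : G -> vfield) (m : nat)
    (a : 'M[R]_m) (u : 'I_m -> G) : tensor2 := fun c p =>
  \sum_(i < m) \sum_(j < m) a i j *: vwedge (A (u i)) (A (u j)) c p.

End Tensors.

Arguments vfield {R n} M.
Arguments tensor2 {R n} M.

(* Main.v *)
Require Import Defs.
From HB Require Import structures.
From mathcomp Require Import all_boot all_order all_algebra.
From mathcomp Require Import all_classical all_reals all_analysis.
From mathcomp Require Import ring lra.

Import Order.TTheory GRing.Theory Num.Theory.
Import numFieldNormedType.Exports.
Local Open Scope classical_set_scope.
Local Open Scope ring_scope.

(** The argument is carried out in one chart at a time.  At a point p of the
    chart c, the i-th component of the action is a linear form on the Lie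
    algebra, xi_i(v) = A(v)^i, and so is its k-th partial derivative eta_ki.
    The bivector field P of the action has components P^ij = r(xi_i, xi_j), so
    that each of the three properties to be proved becomes an identity between
    r, the forms xi and eta and the bracket, which the action turns into
    xi_j([v, w]) = \sum_i (xi_i(v) eta_ij(w) - xi_i(w) eta_ij(v)).

    - The Schouten bracket of P with itself is, up to the factor 2, the left
      hand side of the Yang-Baxter equation at the forms xi_i, xi_j, xi_k.

    - A Killing field has divergence 0, whence the divergence of P is the sum
      of the covariant derivatives of A(y_t) along A(x_t), for any writing of r
      as a sum of tensors x_t (x) y_t.  As r is alternating and the Levi-Civita
      connection is torsion-free, this is half the image under the action of
      \sum_t [x_t, y_t].  This element of G vanishes
      ([unimodular_splitting]): the Yang-Baxter equation says that the inverse
      of r on Im r is a closed 2-form, and contracting the closedness condition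
      with r identifies the pairing of \sum_t [x_t, y_t] with an element u of
      Im r with twice the trace of ad_u on Im r.

    - If f is a Casimir function, then the form v |-> A(v) f, evaluated at p,
      is sent by r to an element that the action kills at p, hence to 0, the
      action being locally free.  So A(v) f = 0 for every v in Im r
      ([casimir_annihilated]).  A Killing field that annihilates f commutes
      with the gradient of f ([killing_gradient_commute]), and P is a sum of
      products of fields A(v) with v in Im r: its Lie derivative along the
      gradient vanishes.

    The analysis behind these computations is the product rule for directional
    derivatives, the derivability of the inverse of the metric, and the
    symmetry of second derivatives ([derive_comm]). *)

(** * Alternating solutions of the Yang-Baxter equation *)

Section LieAlgebra.
Context {R : realType} {G : lieAlgebra R}.
Implicit Types (r : {biscalar lie_dual G}) (a b c : lie_dual G) (u v w : G).

Lemma ecobasis_expansion v :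
  v = \sum_i ecobasis i v *: ebasis`_i.
Proof.
rewrite [LHS](coord_vbasis (memvf v)); apply: eq_bigr => i _.
by rewrite lfunE.
Qed.

Lemma lie_dual_separates v w : (forall a, a v = a w) -> v = w.
Proof.
move=> vw; rewrite [v]ecobasis_expansion [w]ecobasis_expansion.
by apply: eq_bigr => i _; rewrite vw.
Qed.

(** Turns a pointwise linear function, such as a component of the action or its
    derivative, into an argument of r. *)
Lemma linear_form_lie_dual (F : G -> R) :
  (forall k u v, F (k *: u + v) = k * F u + F v) ->
  exists a, forall u, a u = F u.
Proof.
move=> F_lin; have F0 : F 0 = 0.
  by rewrite -[X in F X](addNr 0) -scaleN1r F_lin mulN1r addNr.
exists (\sum_(i < \dim {:G}) F ebasis`_i *: ecobasis i) => u.
rewrite sum_lfunE [in RHS](ecobasis_expansion u).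
rewrite (big_morph F (id1 := 0) (op1 := +%R)) //; last first.
  by move=> v w; rewrite -[v]scale1r F_lin mul1r scale1r.
apply: eq_bigr => i _; rewrite !lfunE /= -[in RHS](addr0 (_ *: _)) F_lin F0 addr0.
by rewrite [ecobasis i u]lfunE /GRing.scale /= mulrC.
Qed.

Lemma alternating_antisym r a b : is_alternating r -> r a b = - r b a.
Proof.
move=> r_alt; have := r_alt (a + b).
rewrite linearDl linearDr /= !linearDr /= !r_alt add0r addr0 => /eqP.
by rewrite addr_eq0 => /eqP.
Qed.

Lemma lie_antisym u v : lie G u v = - lie G v u.
Proof.
have := lie_alt (u + v).
rewrite linearDl linearDr /= !linearDr /= !lie_alt add0r addr0 => /eqP.
by rewrite addr_eq0 => /eqP.
Qed.

(** The Yang-Baxter equation reads a([r b, r c]) = th(r a) for every form a, where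
    th depends on b and c only.  As r is alternating, [r b, r c] = - r th. *)
Lemma im_sharp_lie r u v : is_alternating r -> cybe r ->
  u \in im_sharp r -> v \in im_sharp r -> lie G u v \in im_sharp r.
Proof.
move=> r_alt r_cybe /im_sharpP[b ->] /im_sharpP[c ->].
have [th thE] : exists th : lie_dual G, forall x,
    th x = - b (lie G (sharp r c) x) - c (lie G x (sharp r b)).
  apply: linear_form_lie_dual => k x y.
  by rewrite linearPl linearPr /= !linearP /=; rewrite /GRing.scale /=; ring.
apply/im_sharpP; exists (- th); apply: lie_dual_separates => a.
have := r_cybe a b c => /eqP; rewrite -addrA addr_eq0 => /eqP ->.
by rewrite sharpE linearNr /= -(alternating_antisym _ _ _ r_alt) -sharpE thE opprD.
Qed.

(** With w_t a basis of Im r and k_t its coordinate forms, r is the sum of the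
    tensors (r k_t) (x) w_t.  For b_t such that w_t = r b_t and u = r c, summing
    the Yang-Baxter equation at k_t, b_t, c over t gives
      \sum_t k_t([w_t, u]) + \sum_t b_t([u, r k_t]) + c(\sum_t [r k_t, w_t]) = 0.
    The first two sums are both minus the trace of ad_u on Im r. *)
Lemma unimodular_splitting r :
  is_alternating r -> cybe r -> unimodular r ->
  exists d (x y : 'I_d -> G),
  [/\ forall t, x t \in im_sharp r /\ y t \in im_sharp r,
      forall a b, r a b = \sum_t a (x t) * b (y t) &
      \sum_t lie G (x t) (y t) = 0].
Proof.
move=> r_alt r_cybe r_unim; set W := im_sharp r.
have rN a b : r a b = - r b a by apply: alternating_antisym.
pose w t := (vbasis W)`_t.
have wW t : (t < \dim W)%N -> w t \in W.
  by move=> t_lt; rewrite vbasis_mem // mem_nth // size_tuple.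
have Wexp v : v \in W -> v = \sum_(t < \dim W) coord (vbasis W) t v *: w t.
  by move/coord_vbasis.
have [k kE] : exists k : 'I_(\dim W) -> lie_dual G,
    forall t v, k t v = coord (vbasis W) t v.
  exists (fun t => linfun (coord (vbasis W) t : G -> R^o)) => t v.
  by rewrite lfunE.
(* The b_t represent the inverse of r on Im r. *)
have [b bE] : exists b : 'I_(\dim W) -> lie_dual G,
    forall t, sharp r (b t) = w t.
  have /choice[b bE] : forall t : 'I_(\dim W), exists bt, w t = sharp r bt.
    by move=> t; apply/im_sharpP/wW.
  by exists b => t; rewrite bE.
have sharpW a : sharp r a \in W by apply/im_sharpP; exists a.
(* Expanding r a in the basis w_t and moving a across r by antisymmetry. *)
have sharp_exp a : sharp r a = - \sum_t a (sharp r (k t)) *: w t.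
  rewrite [LHS]Wexp // -sumrN; apply: eq_bigr => t _.
  by rewrite -kE sharpE rN -sharpE scaleNr.
exists (\dim W), (fun t => sharp r (k t)), (fun t => w t); split.
- by move=> t; rewrite sharpW wW.
- move=> a c; rewrite rN -sharpE sharp_exp linearN /= opprK linear_sum /=.
  by apply: eq_bigr => t _; rewrite linearZ.
apply: lie_dual_separates => c; rewrite linear0 linear_sum /=.
pose u := sharp r c.
have trE : \sum_t k t (lie G u (w t)) = 0.
  rewrite -[RHS](r_unim _ (sharpW c)) /trace_ad_on /mxtrace.
  by apply: eq_bigr => t _; rewrite mxE kE.
have trE' : \sum_t b t (lie G u (sharp r (k t))) = 0.
  transitivity (- \sum_t k t (lie G u (w t))); last by rewrite trE oppr0.
  under eq_bigr => t _.
    rewrite sharp_exp linearNr linear_sumr linearN linear_sum /=.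
    over.
  rewrite sumrN exchange_big /=; congr (- _); apply: eq_bigr => s _.
  under eq_bigr => t _ do rewrite linearZr linearZ /=.
  (* It remains to see that \sum_t k_t(r k_s) b_t(v) = k_s(v) for v = [u, w_s];
     this holds for v in Im r, hence the need for Im r to be a subalgebra. *)
  have /im_sharpP[y ->] : lie G u (w s) \in W.
    by apply: im_sharp_lie; rewrite ?sharpW ?wW.
  rewrite [RHS]sharpE rN -sharpE [in RHS](Wexp _ (sharpW _)) linear_sum -sumrN.
  apply: eq_bigr => t _; rewrite linearZ /= -kE.
  by rewrite (sharpE _ (b t)) (rN (b t)) -sharpE bE -mulrN.
transitivity (\sum_(t < \dim W) (k t (lie G (w t) u)
    + b t (lie G u (sharp r (k t))) + c (lie G (sharp r (k t)) (w t)))).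
  rewrite !big_split /= trE' addr0; under [X in _ = X + _]eq_bigr => t _.
    rewrite lie_antisym linearN /=.
    over.
  by rewrite sumrN trE oppr0 add0r.
by rewrite big1 // => t _; rewrite -bE; apply: r_cybe.
Qed.
End LieAlgebra.

(** * Directional derivatives and the symmetry of second derivatives *)

Section DirectionalDerivatives.
Context {R : realType} {V : normedModType R}.
Implicit Types (f h : V -> R) (x v w : V).

Lemma near_eq_continuous f h x : (\near x, f x = h x) ->
  {for x, continuous f} -> {for x, continuous h}.
Proof.
move=> fh fx; suff : h @ x --> f x by rewrite (nbhs_singleton fh).
by apply: cvg_trans fx; apply: near_eq_cvg.
Qed.

Lemma derivable_prod (I : Type) (s : seq I) (F : I -> V -> R) x v :
  (forall i, derivable (F i) x v) ->
  derivable (fun y => \prod_(i <- s) F i y) x v.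
Proof.
move=> dF; elim: s => [|i s IHs].
  under eq_fun do rewrite big_nil.
  exact: derivable_cst.
under eq_fun do rewrite big_cons.
exact: (derivableM (dF i) IHs).
Qed.

Lemma derivable_bigsum (I : Type) (s : seq I) (F : I -> V -> R) x v :
  (forall i, derivable (F i) x v) ->
  derivable (fun y => \sum_(i <- s) F i y) x v.
Proof.
move=> dF; elim: s => [|i s IHs].
  under eq_fun do rewrite big_nil.
  exact: derivable_cst.
under eq_fun do rewrite big_cons.
exact: (derivableD (dF i) IHs).
Qed.

Lemma derivable_det m (B : V -> 'M[R]_m) x v :
  (forall i j, derivable (fun y => B y i j) x v) ->
  derivable (fun y => \det (B y)) x v.
Proof.
move=> dB; apply: derivable_bigsum => s.
by apply: derivableM; [exact: derivable_cst | apply: derivable_prod].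
Qed.

(** Cramer's rule expresses the entries of the inverse as quotients of
    polynomials in the entries. *)
Lemma derivable_invmx m (B : V -> 'M[R]_m) x v i j :
  (\near x, B x \in unitmx) ->
  (forall i j, derivable (fun y => B y i j) x v) ->
  derivable (fun y => invmx (B y) i j) x v.
Proof.
move=> uB dB.
apply: (@near_eq_derivable _ _ _ (fun y => (\det (B y))^-1 * (\adj (B y)) i j)).
  near=> y; have uBy : B y \in unitmx by near: y.
  by rewrite /invmx uBy !mxE.
apply: derivableM.
  apply: derivableV; last exact: derivable_det.
  by have := nbhs_singleton uB; rewrite unitmxE unitfE.
under eq_fun do rewrite mxE /cofactor.
apply: derivableM; first exact: derivable_cst.
apply: derivable_det => k l.
under eq_fun do rewrite !mxE.
exact: dB.
Unshelve. all: by end_near. Qed.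

Lemma MVT_along f x v (e : R) : 0 < e ->
  (forall s, 0 <= s <= e -> derivable f (x + s *: v) v) ->
  exists2 s, 0 <= s <= e & f (x + e *: v) - f x = e * 'D_v f (x + s *: v).
Proof.
move=> e0 df; pose F s := f (x + s *: v).
have dF s : 0 <= s <= e -> is_derive s 1 F ('D_v f (x + s *: v)).
  move=> /df fs; have E :
      (fun h : R => h^-1 *: ((F \o shift s) (h *: (1 : R)) - F s)) =
      (fun h : R =>
         h^-1 *: ((f \o shift (x + s *: v)) (h *: v) - f (x + s *: v))).
    by apply/funext => h; rewrite /F /= [h *: 1]mulr1 scalerDl addrCA.
  by apply: DeriveDef; rewrite /derivable /derive E.
have [] := @MVT_segment R F (fun s => 'D_v f (x + s *: v)) 0 e (ltW e0).
- by move=> s; rewrite in_itv /= => /andP[/ltW s0 /ltW se]; apply: dF; rewrite s0.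
- apply: derivable_within_continuous => s; rewrite in_itv /= => s_in.
  by have [] := dF _ s_in.
- move=> s; rewrite in_itv /= => s_in; rewrite /F scale0r addr0 subr0 => fE.
  by exists s => //; rewrite fE mulrC.
Qed.

(** The second difference of f over a small parallelogram is e^2 times a mixed
    derivative at some point of it: the mean value theorem is applied along v to
    the difference of f in the direction w, then along w to the derivative of f
    in the direction v. *)
Lemma second_difference f x v w (e : R) : 0 < e ->
  (forall s t : R, 0 <= s <= e -> 0 <= t <= e ->
    derivable f (x + s *: v + t *: w) v /\
    derivable ('D_v f) (x + s *: v + t *: w) w) ->
  exists s t : R, [/\ 0 <= s <= e, 0 <= t <= e &
    f (x + e *: v + e *: w) - f (x + e *: v) - f (x + e *: w) + f x
    = e * (e * 'D_w ('D_v f) (x + s *: v + t *: w))].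
Proof.
move=> e0 df; pose F := (fun y => f (y + e *: w)) \- f.
have e_in : 0 <= e <= e by rewrite lexx ltW.
have z_in : 0 <= (0 : R) <= e by rewrite lexx ltW.
have dshift s : 0 <= s <= e ->
    is_derive (x + s *: v) v (fun y => f (y + e *: w))
      ('D_v f (x + s *: v + e *: w)).
  move=> s_in; have [fs _] := df _ _ s_in e_in.
  have E :
      (fun h : R => h^-1 *: (((fun y => f (y + e *: w)) \o shift (x + s *: v))
                               (h *: v) - f (x + s *: v + e *: w))) =
      (fun h : R => h^-1 *: ((f \o shift (x + s *: v + e *: w)) (h *: v)
                             - f (x + s *: v + e *: w))).
    by apply/funext => h /=; rewrite !addrA.
  by apply: DeriveDef; rewrite /derivable /derive E.
have dF s : 0 <= s <= e -> is_derive (x + s *: v) v F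
    ('D_v f (x + s *: v + e *: w) - 'D_v f (x + s *: v)).
  move=> s_in; have := dshift _ s_in => ?.
  have [fs _] := df _ _ s_in z_in; rewrite scale0r addr0 in fs.
  by apply: is_deriveB => //; apply: derivableP.
have [|s s_in FE] := @MVT_along F x v e e0.
  by move=> s s_in; have [] := dF _ s_in.
have [|t t_in fE] := @MVT_along ('D_v f) (x + s *: v) w e e0.
  by move=> t t_in; have [] := df _ _ s_in t_in.
exists s, t; split => //; rewrite -fE; have [_ <-] := dF _ s_in; rewrite -FE /F.
by rewrite /= !opprD !opprK !addrA; ring.
Qed.

(** The second difference of f over a parallelogram is symmetric in v and w, so
    that by [second_difference] the two mixed derivatives take a common value at
    two points that are arbitrarily close to x; by continuity they agree at x. *)
Lemma derive_comm f x v w :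
  (\near x, derivable f x v /\ derivable f x w) ->
  (\near x, derivable ('D_v f) x w /\ derivable ('D_w f) x v) ->
  {for x, continuous ('D_w ('D_v f))} -> {for x, continuous ('D_v ('D_w f))} ->
  'D_w ('D_v f) x = 'D_v ('D_w f) x.
Proof.
move=> df ddf cvw cwv; apply/eqP; rewrite -subr_eq0 -normr_eq0.
apply/negPn/negP => ne0; pose e := `|'D_w ('D_v f) x - 'D_v ('D_w f) x| / 2.
have e0 : 0 < e by rewrite divr_gt0 // lt0r ne0 normr_ge0.
have near_w : \forall y \near x, `|'D_w ('D_v f) x - 'D_w ('D_v f) y| < e.
  by move/cvgrPdist_lt: cvw; apply.
have near_v : \forall y \near x, `|'D_v ('D_w f) x - 'D_v ('D_w f) y| < e.
  by move/cvgrPdist_lt: cwv; apply.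
have /nbhs_ballP[d /= d0 dP] : \forall y \near x,
    [/\ derivable f y v /\ derivable f y w,
    derivable ('D_v f) y w /\ derivable ('D_w f) y v,
    `|'D_w ('D_v f) x - 'D_w ('D_v f) y| < e &
    `|'D_v ('D_w f) x - 'D_v ('D_w f) y| < e].
  apply: filterS (filterI (filterI df ddf) (filterI near_w near_v)).
  by move=> y [[? ?] [? ?]].
have k0 : 0 < `|v| + `|w| + 1 by rewrite ltr_wpDl // addr_ge0.
(* The side of the parallelogram: small enough for it to stay in the ball of
   radius d, the summand 1 keeping the denominator positive. *)
pose k := d / (`|v| + `|w| + 1).
have k_gt0 : 0 < k by apply: divr_gt0.
have square s t : 0 <= s <= k -> 0 <= t <= k -> ball x d (x + s *: v + t *: w).
  move=> /andP[s0 sk] /andP[t0 tk]; rewrite -ball_normE /= -addrA opprD addrA subrr.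
  rewrite sub0r normrN (le_lt_trans (ler_normD _ _)) // !normrZ !ger0_norm //.
  apply: (@le_lt_trans _ _ (k * (`|v| + `|w|))).
    by rewrite mulrDr lerD // ler_wpM2r.
  by rewrite -[ltRHS](divfK (lt0r_neq0 k0)) -/k ltr_pM2l // ltrDl ltr01.
have [|s [t [s_in t_in fvw]]] := @second_difference f x v w k k_gt0.
  move=> s t s_in t_in; have [[dv _] [dw _] _ _] := dP _ (square _ _ s_in t_in).
  exact: conj dv dw.
have [|s' [t' [s'_in t'_in fwv]]] := @second_difference f x w v k k_gt0.
  move=> s' t' s'_in t'_in; rewrite addrAC.
  have [[_ dw] [_ dv] _ _] := dP _ (square _ _ t'_in s'_in).
  exact: conj dw dv.
have [_ _ near_vw _] := dP _ (square _ _ s_in t_in).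
have [_ _ _] := dP _ (square _ _ t'_in s'_in).
rewrite addrAC => near_wv.
(* A common value would be within e of both mixed derivatives at x, whose
   distance is 2 e. *)
suff E : 'D_w ('D_v f) (x + s *: v + t *: w)
    = 'D_v ('D_w f) (x + s' *: w + t' *: v).
  rewrite E in near_vw; have := ltrD near_vw near_wv; rewrite -splitr ltNge.
  by move=> /negP; apply; rewrite [X in _ <= _ + X]distrC ler_distD.
apply: (mulfI (lt0r_neq0 k_gt0)); apply: (mulfI (lt0r_neq0 k_gt0)).
refine (etrans (esym fvw) (etrans _ fwv)).
rewrite [x + k *: w + k *: v]addrAC; congr (_ + _); exact: addrAC.
Qed.
End DirectionalDerivatives.

(** * Smooth functions on open sets *)

Section SmoothFunctions.
Context {R : realType} {n : nat}.
Implicit Types (V : set 'rV[R]_n) (f h : 'rV[R]_n -> R).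

(** Formulas in a chart hold on its image only, whence this extensionality on an
    open set. *)
Lemma Ck_eq k V f h : open V -> (forall x, V x -> f x = h x) ->
  Ck k V f -> Ck k V h.
Proof.
move=> oV; elim: k f h => [|k IHk] f h fh.
  case=> cf _; split=> // x Vx; apply: near_eq_continuous (cf x Vx).
  by apply: filterS fh _; apply: open_nbhs_nbhs.
have near_fh x : V x -> \near x, f x = h x.
  by move=> Vx; apply: filterS fh _; apply: open_nbhs_nbhs.
case=> cf df; split=> [x Vx|i].
  by apply: near_eq_continuous (cf x Vx); apply: near_fh.
have [dfi Cdf] := df i; split=> [x Vx|].
  by apply: near_eq_derivable (dfi x Vx); apply: near_fh.
apply: IHk Cdf => x Vx; apply: near_eq_derive; exact: near_fh.
Qed.

Lemma CkW k V f : Ck k.+1 V f -> Ck k V f.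
Proof.
elim: k f => [|k IHk] f [cf df]; split=> // i; have [dfi Cdf] := df i.
by split=> //; apply: IHk.
Qed.

Lemma Ck_cst k V (c : R) : Ck k V (fun=> c).
Proof.
elim: k c => [|k IHk] c; first by split=> // x _; exact: cst_continuous.
split=> [x _|i]; first exact: cst_continuous.
split=> [x _|]; first exact: derivable_cst.
by under eq_fun do rewrite (@derive_cst _ _ _ c); apply: IHk.
Qed.

Lemma CkD k V f h : open V -> Ck k V f -> Ck k V h -> Ck k V (fun x => f x + h x).
Proof.
move=> oV; elim: k f h => [|k IHk] f h [cf df] [ch dh].
  by split=> // x Vx; apply: continuousD; [apply: cf | apply: ch].
split=> [x Vx|i]; first by apply: continuousD; [apply: cf | apply: ch].
have [dfi Cdf] := df i; have [dhi Cdh] := dh i; split=> [x Vx|].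
  by apply: derivableD; [apply: dfi | apply: dhi].
apply: Ck_eq (IHk _ _ Cdf Cdh) => // x Vx.
by rewrite -(deriveD (dfi x Vx) (dhi x Vx)).
Qed.

Lemma CkM k V f h : open V -> Ck k V f -> Ck k V h -> Ck k V (fun x => f x * h x).
Proof.
move=> oV; elim: k f h => [|k IHk] f h.
  by case=> [cf _] [ch _]; split=> // x Vx; apply: continuousM; [apply: cf | apply: ch].
move=> Cf Ch; have [cf df] := Cf; have [ch dh] := Ch.
split=> [x Vx|i]; first by apply: continuousM; [apply: cf | apply: ch].
have [dfi Cdf] := df i; have [dhi Cdh] := dh i; split=> [x Vx|].
  by apply: derivableM; [apply: dfi | apply: dhi].
apply: Ck_eq (CkD _ _ _ _ oV (IHk _ _ (CkW _ _ _ Cf) Cdh)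
  (IHk _ _ (CkW _ _ _ Ch) Cdf)) => // x Vx.
by rewrite -[LHS](deriveM (dfi x Vx) (dhi x Vx)).
Qed.

Lemma smooth_sum_mul V d (F H : 'I_d -> 'rV[R]_n -> R) : open V ->
  (forall t, smooth V (F t)) -> (forall t, smooth V (H t)) ->
  smooth V (fun x => \sum_t F t x * H t x).
Proof.
move=> oV sF sH k; elim: (index_enum _) => [|t s IHs].
  by under eq_fun do rewrite big_nil; apply: Ck_cst.
under eq_fun do rewrite big_cons.
by apply: CkD => //; apply: CkM => //; [apply: sF | apply: sH].
Qed.

Lemma smooth_derivable V f x i : smooth V f -> V x -> derivable f x (basisvec i).
Proof. by move=> /(_ 1%N)[_ /(_ i)[df _]]; apply: df. Qed.

Lemma smooth_derive V f i : smooth V f -> smooth V ('D_(basisvec i) f).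
Proof. by move=> sf k; have [_ /(_ i)[]] := sf k.+1. Qed.

Lemma smooth_derive_comm V f x i j : open V -> smooth V f -> V x ->
  'D_(basisvec j) ('D_(basisvec i) f) x = 'D_(basisvec i) ('D_(basisvec j) f) x.
Proof.
move=> oV sf Vx; apply: derive_comm.
- apply: filterS (open_nbhs_nbhs (conj oV Vx)) => y Vy.
  exact: conj (smooth_derivable _ _ _ _ sf Vy) (smooth_derivable _ _ _ _ sf Vy).
- apply: filterS (open_nbhs_nbhs (conj oV Vx)) => y Vy.
  split; apply: smooth_derivable Vy; exact: smooth_derive.
- by have [cf _] := smooth_derive _ _ j (smooth_derive _ _ i sf) 0%N; apply: cf.
- by have [cf _] := smooth_derive _ _ i (smooth_derive _ _ j sf) 0%N; apply: cf.
Qed.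
End SmoothFunctions.

(** * Partial derivatives in a chart *)

Section Charts.
Context {R : realType} {n : nat} {M : manifold R n}.
Implicit Types (c : chart M) (p q : M) (U : set M) (i j k : 'I_n) (f h : M -> R).

(** The image of the chart is open and its inverse is continuous there. *)
Lemma chart_image_open c U : open U -> open (chart_map c @` (chart_dom c `&` U)).
Proof.
move=> oU; rewrite openE => _ [p [cp Up] <-].
have im_cp : (chart_map c @` chart_dom c) (chart_map c p) by exists p.
have near_im : \forall y \near chart_map c p, (chart_map c @` chart_dom c) y.
  exact: open_nbhs_nbhs (conj (@image_open _ _ _ c) im_cp).
have near_U : \forall y \near chart_map c p, U (chart_inv c y).
  apply: (chart_inv_continuous im_cp); rewrite chart_mapK //.
  exact: open_nbhs_nbhs (conj oU Up).
apply: filterS (filterI near_im near_U) => _ [[q cq <-] Uq].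
by exists q => //; split=> //; rewrite chart_mapK in Uq.
Qed.

Lemma chart_image_nbhs c U p : open U -> chart_dom c p -> U p ->
  \forall y \near chart_map c p, chart_dom c (chart_inv c y) /\ U (chart_inv c y).
Proof.
move=> oU cp Up; have im_p : (chart_map c @` (chart_dom c `&` U)) (chart_map c p).
  by exists p.
apply: filterS (open_nbhs_nbhs (conj (chart_image_open c U oU) im_p)).
by move=> _ [q [cq Uq] <-]; rewrite chart_mapK.
Qed.

Definition chart_derivable c i f p :=
  derivable (f \o chart_inv c) (chart_map c p) (basisvec i).

Lemma chart_smooth_derivable c i U f p : chart_smooth c U f ->
  chart_dom c p -> U p -> chart_derivable c i f p.
Proof. by move=> sf cp Up; apply: smooth_derivable sf _; exists p. Qed.

Lemma eq_partial c i U f h p : open U -> chart_dom c p -> U p ->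
  (forall q, chart_dom c q -> U q -> f q = h q) -> partial c i f p = partial c i h p.
Proof.
move=> oU cp Up fh; apply: near_eq_derive.
by apply: filterS (chart_image_nbhs c U p oU cp Up) => y [cy Uy]; apply: fh.
Qed.

Lemma partialD c i f h p : chart_derivable c i f p -> chart_derivable c i h p ->
  partial c i (fun q => f q + h q) p = partial c i f p + partial c i h p.
Proof. exact: deriveD. Qed.

Lemma partialM c i f h p : chart_dom c p ->
  chart_derivable c i f p -> chart_derivable c i h p ->
  partial c i (fun q => f q * h q) p = partial c i f p * h p + f p * partial c i h p.
Proof.
move=> cp df dh; rewrite [LHS](deriveM df dh) /= chart_mapK //.
by rewrite addrC; congr (_ + _); exact: mulrC.
Qed.

Lemma chart_derivableM c i f h p :
  chart_derivable c i f p -> chart_derivable c i h p ->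
  chart_derivable c i (fun q => f q * h q) p.
Proof. exact: derivableM. Qed.

Lemma partialZ c i (k : R) f p : chart_derivable c i f p ->
  partial c i (fun q => k * f q) p = k * partial c i f p.
Proof. exact: deriveZ. Qed.

Lemma chart_derivable_sum c i d (F : 'I_d -> M -> R) p :
  (forall t, chart_derivable c i (F t) p) ->
  chart_derivable c i (fun q => \sum_t F t q) p.
Proof. exact: derivable_bigsum. Qed.

Lemma partial_cst c i (k : R) p : partial c i (fun=> k) p = 0.
Proof. exact: derive_cst. Qed.

Lemma partial_sum c i d (F : 'I_d -> M -> R) p :
  (forall t, chart_derivable c i (F t) p) ->
  partial c i (fun q => \sum_t F t q) p = \sum_t partial c i (F t) p.
Proof.
move=> dF; rewrite -derive_sum //; congr ('D_ _ _ _).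
by apply/funext => y; rewrite fct_sumE.
Qed.

Lemma partial_sum_mul c i d (F H : 'I_d -> M -> R) p : chart_dom c p ->
  (forall t, chart_derivable c i (F t) p) ->
  (forall t, chart_derivable c i (H t) p) ->
  partial c i (fun q => \sum_t F t q * H t q) p =
  \sum_t (partial c i (F t) p * H t p + F t p * partial c i (H t) p).
Proof.
move=> cp dF dH; rewrite partial_sum => [|t]; last exact: chart_derivableM.
by apply: eq_bigr => t _; rewrite partialM.
Qed.

(** The local expression of a partial derivative is the directional derivative of
    the local expression on the image of the chart only, where the chart cancels
    its inverse. *)
Lemma near_partial c k f p : chart_dom c p ->
  \forall y \near chart_map c p,
    'D_(basisvec k) (f \o chart_inv c) y = (partial c k f \o chart_inv c) y.
Proof.
move=> cp; have im_p : (chart_map c @` chart_dom c) (chart_map c p) by exists p.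
apply: filterS (open_nbhs_nbhs (conj (@image_open _ _ _ c) im_p)).
by move=> _ [q cq <-]; rewrite /= chart_mapK.
Qed.

Lemma partial_derivable c U i k f p : chart_smooth c U f ->
  chart_dom c p -> U p -> chart_derivable c i (partial c k f) p.
Proof.
move=> sf cp Up; apply: near_eq_derivable (near_partial c k f p cp) _.
by apply: smooth_derivable (smooth_derive _ _ k sf) _; exists p.
Qed.

Lemma partial_comm c U i j f p : open U -> chart_smooth c U f ->
  chart_dom c p -> U p ->
  partial c i (partial c j f) p = partial c j (partial c i f) p.
Proof.
move=> oU sf cp Up.
have DE k l : partial c l (partial c k f) p
    = 'D_(basisvec l) ('D_(basisvec k) (f \o chart_inv c)) (chart_map c p).
  by apply: near_eq_derive; apply: filterS (near_partial c k f p cp).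
rewrite !DE (smooth_derive_comm _ _ _ _ _ (chart_image_open c U oU) sf) //.
by exists p.
Qed.
End Charts.

(** * The metric, its gradient and its Killing fields *)

Section Riemannian.
Context {R : realType} {n : nat} {M : manifold R n}.
Implicit Types (c : chart M) (p q : M) (U : set M) (i j k l : 'I_n).
Implicit Types (g P : tensor2 M) (X Y Z : vfield M) (f : M -> R).

Lemma sum_symmetric_antisymmetric (a b : 'I_n -> 'I_n -> R) :
  (forall i j, a i j = a j i) -> (forall i j, b i j = - b j i) ->
  \sum_i \sum_j a i j * b i j = 0.
Proof.
move=> a_sym b_anti; set s := LHS; suff : s = - s by lra.
rewrite {1}/s exchange_big -sumrN /=; apply: eq_bigr => i _.
by rewrite -sumrN; apply: eq_bigr => j _; rewrite a_sym b_anti mulrN.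
Qed.

Lemma vector_field_derivable X c i j p : is_vector_field X -> chart_dom c p ->
  chart_derivable c i (fun q => X c q 0 j) p.
Proof. by move=> [sX _] cp; apply: chart_smooth_derivable (sX c j) _ _. Qed.

Lemma metric_derivable g c k i j p : is_riemannian_metric g -> chart_dom c p ->
  chart_derivable c k (fun q => g c q i j) p.
Proof. by move=> [sg _ _ _] cp; apply: chart_smooth_derivable (sg c i j) _ _. Qed.

Lemma metric_sym g c p i j : is_riemannian_metric g -> chart_dom c p ->
  g c p i j = g c p j i.
Proof. by move=> [_ gT _ _] /gT gE; rewrite -[in LHS]gE mxE. Qed.

Lemma partial_metric_sym g c p k i j : is_riemannian_metric g -> chart_dom c p ->
  partial c k (fun q => g c q i j) p = partial c k (fun q => g c q j i) p.
Proof.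
move=> hg cp; apply: (eq_partial _ _ setT) => //; first exact: openT.
by move=> q cq _; apply: metric_sym.
Qed.

(** A vector in the kernel of the metric would have length 0. *)
Lemma metric_unit g c p : is_riemannian_metric g -> chart_dom c p ->
  g c p \in unitmx.
Proof.
move=> [_ _ gpos _] cp; rewrite -row_free_unit -kermx_eq0; apply/negPn/negP.
case/rowV0Pn => v /sub_kermxP vg v0.
by have := gpos c p v cp v0; rewrite vg mul0mx mxE ltxx.
Qed.

Lemma invmx_metric_sym g c p i j : is_riemannian_metric g -> chart_dom c p ->
  invmx (g c p) i j = invmx (g c p) j i.
Proof.
move=> [_ gT _ _] cp.
have /matrixP/(_ i j) := trmx_inv (g c p).
by rewrite gT // mxE => ->.
Qed.

Lemma sum_metric_invmx g c p i k : is_riemannian_metric g -> chart_dom c p ->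
  \sum_j g c p i j * invmx (g c p) j k = (i == k)%:R.
Proof.
move=> hg cp; have /matrixP/(_ i k) := mulmxV (metric_unit g c p hg cp).
by rewrite !mxE.
Qed.

Lemma gradient_derivable g c U f p i j : is_riemannian_metric g -> open U ->
  chart_smooth c U f -> chart_dom c p -> U p ->
  chart_derivable c i (fun q => gradient g f c q 0 j) p.
Proof.
move=> hg oU sf cp Up; rewrite /gradient.
under eq_fun do rewrite mxE.
apply: chart_derivable_sum => k; apply: chart_derivableM.
  under eq_fun do rewrite mxE.
  exact: partial_derivable sf cp Up.
apply: derivable_invmx => [|k' l]; last exact: metric_derivable.
have : \forall y \near chart_map c p,
  chart_dom c (chart_inv c y) /\ setT (chart_inv c y).
  by apply: chart_image_nbhs => //; apply: openT.
by apply: filterS => y [cy _]; apply: metric_unit.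
Qed.

Lemma gradient_metric g c f p j : is_riemannian_metric g -> chart_dom c p ->
  \sum_i gradient g f c p 0 i * g c p i j = partial c j f p.
Proof.
move=> hg cp; transitivity ((gradient g f c p *m g c p) 0 j); first by rewrite mxE.
by rewrite mulmxKV ?metric_unit // mxE.
Qed.

Lemma christoffel_sym g c p i j k : is_riemannian_metric g -> chart_dom c p ->
  christoffel g c p i j k = christoffel g c p j i k.
Proof.
move=> hg cp; congr (_ * _); apply: eq_bigr => l _; congr (_ * (_ - _)).
  exact: addrC.
exact: partial_metric_sym.
Qed.

(** The other two derivatives of the metric in the Christoffel symbol form an
    expression that is antisymmetric in i and j, which the symmetric inverse
    metric cancels. *)
Lemma christoffel_contraction g c p l : is_riemannian_metric g -> chart_dom c p ->
  \sum_i christoffel g c p i l i =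
  2^-1 * \sum_i \sum_j invmx (g c p) i j * partial c l (fun q => g c q i j) p.
Proof.
move=> hg cp; rewrite /christoffel -mulr_sumr; congr (_ * _).
apply/eqP; rewrite -subr_eq0 -sumrB; apply/eqP.
transitivity (\sum_i \sum_j invmx (g c p) i j *
    (partial c i (fun q => g c q l j) p - partial c j (fun q => g c q l i) p)).
  apply: eq_bigr => i _; rewrite -sumrB; apply: eq_bigr => j _.
  by rewrite (partial_metric_sym _ _ _ j i l) //; ring.
apply: sum_symmetric_antisymmetric => i j; first exact: invmx_metric_sym.
by rewrite opprB.
Qed.

(** Half the contraction of the Lie derivative of the metric with the inverse
    metric is the divergence: its derivatives of X give the first sum, each of
    the two terms giving one half, and its derivatives of the metric give the
    second sum by [christoffel_contraction]. *)
Lemma killing_divergence_free g X c p : is_riemannian_metric g -> killing g X ->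
  chart_dom c p ->
  \sum_i partial c i (fun q => X c q 0 i) p
  + \sum_i \sum_l christoffel g c p i l i * X c p 0 l = 0.
Proof.
move=> hg [_ kX] cp.
have kE i j : \sum_k (X c p 0 k * partial c k (fun q => g c q i j) p
     + g c p k j * partial c i (fun q => X c q 0 k) p
     + g c p i k * partial c j (fun q => X c q 0 k) p) = 0.
  by have /matrixP/(_ i j) := kX c p cp; rewrite !mxE.
pose h := invmx (g c p).
have dX : \sum_i \sum_j h i j * (\sum_k
      g c p k j * partial c i (fun q => X c q 0 k) p)
    = \sum_i partial c i (fun q => X c q 0 i) p.
  apply: eq_bigr => i _.
  transitivity (\sum_k (k == i)%:R * partial c i (fun q => X c q 0 k) p).
    under eq_bigr do rewrite mulr_sumr.
    rewrite exchange_big; apply: eq_bigr => k _.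
    rewrite -(sum_metric_invmx g c p) // mulr_suml; apply: eq_bigr => j _.
    by rewrite mulrCA mulrA (invmx_metric_sym _ _ _ j i).
  rewrite (bigD1 i) //= eqxx mul1r big1 ?addr0 // => k /negPf ->.
  by rewrite mul0r.
have dX' : \sum_i \sum_j h i j * (\sum_k
      g c p i k * partial c j (fun q => X c q 0 k) p)
    = \sum_i partial c i (fun q => X c q 0 i) p.
  rewrite -dX exchange_big; apply: eq_bigr => i _; apply: eq_bigr => j _.
  rewrite [h j i]invmx_metric_sym //; congr (_ * _); apply: eq_bigr => k _.
  by rewrite metric_sym.
have gX : \sum_i \sum_l christoffel g c p i l i * X c p 0 l =
    2^-1 * \sum_i \sum_j h i j *
      (\sum_k X c p 0 k * partial c k (fun q => g c q i j) p).
  rewrite exchange_big /=.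
  transitivity (\sum_k 2^-1 *
    ((\sum_i \sum_j h i j * partial c k (fun q => g c q i j) p) * X c p 0 k)).
    by apply: eq_bigr => k _; rewrite -mulr_suml christoffel_contraction // mulrA.
  rewrite -mulr_sumr; congr (_ * _).
  under [LHS]eq_bigr do rewrite mulr_suml.
  rewrite exchange_big; apply: eq_bigr => i _.
  under [LHS]eq_bigr do rewrite mulr_suml.
  rewrite exchange_big; apply: eq_bigr => j _; rewrite mulr_sumr.
  by apply: eq_bigr => k _; ring.
have : \sum_i \sum_j h i j * \sum_k (X c p 0 k * partial c k (fun q => g c q i j) p
     + g c p k j * partial c i (fun q => X c q 0 k) p
     + g c p i k * partial c j (fun q => X c q 0 k) p) = 0.
  by rewrite big1 // => i _; rewrite big1 // => j _; rewrite kE mulr0.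
under eq_bigr => i _ do
  (under eq_bigr => j _ do rewrite !big_split !mulrDr; rewrite !big_split).
rewrite !big_split /= dX dX' => kg.
rewrite gX; lra.
Qed.
End Riemannian.

(** * Gradients commute with Killing fields *)

Section KillingGradient.
Context {R : realType} {n : nat} {M : manifold R n}.
Implicit Types (c : chart M) (p q : M) (U : set M) (i j k l : 'I_n).
Implicit Types (g P : tensor2 M) (X Y Z : vfield M) (f : M -> R).

(** Lowering the index of [grad f, X] with the metric, and using that the Lie
    derivative of the metric along X vanishes, gives minus the differential of
    X f.  This uses that the second derivatives of f commute. *)
Lemma killing_gradient_commute g X c U f p : is_riemannian_metric g ->
  killing g X -> open U -> chart_smooth c U f ->
  (forall q, chart_dom c q -> U q -> \sum_k X c q 0 k * partial c k f q = 0) ->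
  chart_dom c p -> U p -> vbracket (gradient g f) X c p = 0.
Proof.
move=> hg kX oU sf Xf cp Up; pose Z := gradient g f.
have dX i j : chart_derivable c i (fun q => X c q 0 j) p.
  by apply: vector_field_derivable => //; case: kX.
have dZ i j : chart_derivable c i (fun q => Z c q 0 j) p.
  exact: gradient_derivable hg oU sf cp Up.
have dg k i j : chart_derivable c k (fun q => g c q i j) p.
  exact: metric_derivable.
have ddf i k : chart_derivable c i (partial c k f) p.
  exact: partial_derivable sf cp Up.
(* Derivative of df = g (grad f, _). *)
have gradE k j : partial c k (partial c j f) p =
    \sum_i (partial c k (fun q => Z c q 0 i) p * g c p i j
            + Z c p 0 i * partial c k (fun q => g c q i j) p).
  rewrite -partial_sum_mul //; apply: (eq_partial c k U) => // q cq _.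
  by rewrite gradient_metric.
have dXf j : \sum_k (partial c j (fun q => X c q 0 k) p * partial c k f p
                     + X c p 0 k * partial c j (partial c k f) p) = 0.
  rewrite -partial_sum_mul //; rewrite -[RHS](partial_cst c j 0 p).
  exact: (eq_partial c j U).
have kE i j : \sum_k (X c p 0 k * partial c k (fun q => g c q i j) p
     + g c p k j * partial c i (fun q => X c q 0 k) p
     + g c p i k * partial c j (fun q => X c q 0 k) p) = 0.
  by have [_ /(_ c p cp)/matrixP/(_ i j)] := kX; rewrite !mxE.
(* The metric is invertible. *)
suff Bg : vbracket Z X c p *m g c p = 0.
  by rewrite -[LHS](mulmxK (metric_unit g c p hg cp)) Bg mul0mx.
apply/rowP => j; rewrite !mxE.
transitivity (\sum_i \sum_k
   (Z c p 0 k * partial c k (fun q => X c q 0 i) p * g c p i j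
    - X c p 0 k * partial c k (fun q => Z c q 0 i) p * g c p i j)).
  by apply: eq_bigr => i _; rewrite mxE mulr_suml; apply: eq_bigr => k _; ring.
have E1 : \sum_i \sum_k X c p 0 k * partial c k (fun q => Z c q 0 i) p * g c p i j
  = \sum_k X c p 0 k * partial c k (partial c j f) p
    - \sum_i \sum_k Z c p 0 i * (X c p 0 k * partial c k (fun q => g c q i j) p).
  rewrite exchange_big [X in _ - X]exchange_big -sumrB; apply: eq_bigr => k _.
  rewrite gradE mulr_sumr -sumrB; apply: eq_bigr => i _; ring.
(* The Killing equation, contracted with the gradient Z. *)
have E2 : \sum_i \sum_k
     (Z c p 0 i * (X c p 0 k * partial c k (fun q => g c q i j) p)
     + Z c p 0 k * partial c k (fun q => X c q 0 i) p * g c p i j)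
     + \sum_k partial c j (fun q => X c q 0 k) p * partial c k f p = 0.
  transitivity (\sum_i Z c p 0 i * \sum_k
    (X c p 0 k * partial c k (fun q => g c q i j) p
     + g c p k j * partial c i (fun q => X c q 0 k) p
     + g c p i k * partial c j (fun q => X c q 0 k) p)); last first.
    by rewrite big1 // => i _; rewrite kE mulr0.
  have E3 : \sum_k partial c j (fun q => X c q 0 k) p * partial c k f p
     = \sum_i \sum_k Z c p 0 i * g c p i k * partial c j (fun q => X c q 0 k) p.
    rewrite exchange_big; apply: eq_bigr => k _.
    by rewrite -(gradient_metric g c f p k hg cp) mulrC mulr_suml.
  have E4 : \sum_i \sum_k Z c p 0 k * partial c k (fun q => X c q 0 i) p * g c p i j
     = \sum_i \sum_k Z c p 0 i * partial c i (fun q => X c q 0 k) p * g c p k j.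
    by rewrite exchange_big.
  rewrite E3; under eq_bigr do rewrite big_split.
  rewrite big_split E4 -!big_split; apply: eq_bigr => i _ /=.
  rewrite mulr_sumr -!big_split; apply: eq_bigr => k _ /=; ring.
have {dXf} := dXf j; rewrite big_split /=.
under [X in _ + X = _]eq_bigr do rewrite (partial_comm c U j _ f p oU sf cp Up).
move: E2; under [X in X + _ = _]eq_bigr do rewrite big_split.
rewrite big_split /=.
under [X in _ -> _ -> X = _]eq_bigr do rewrite sumrB.
rewrite sumrB E1.
move: (\sum_i _) => s1; move: (\sum_i _) => s2; move: (\sum_i _) => s3.
move: (\sum_i _) => s4; lra.
Qed.

Lemma partial_splitting c m i j d (P : M -> 'M[R]_n) (X Y : 'I_d -> vfield M) p :
  (forall t, is_vector_field (X t)) -> (forall t, is_vector_field (Y t)) ->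
  (forall q i j, chart_dom c q -> P q i j = \sum_t X t c q 0 i * Y t c q 0 j) ->
  chart_dom c p ->
  partial c m (fun q => P q i j) p =
  \sum_t (partial c m (fun q => X t c q 0 i) p * Y t c p 0 j
          + X t c p 0 i * partial c m (fun q => Y t c q 0 j) p).
Proof.
move=> vX vY PE cp; rewrite -partial_sum_mul // => [|t|t].
- apply: (eq_partial c m setT) => //; first exact: openT.
  by move=> q cq _; apply: PE.
- exact: vector_field_derivable.
- exact: vector_field_derivable.
Qed.

(** The Lie derivative is a derivation of the tensor product. *)
Lemma lie_deriv_contra_splitting Z (P : tensor2 M) d (X Y : 'I_d -> vfield M) c p i j :
  (forall t, is_vector_field (X t)) -> (forall t, is_vector_field (Y t)) ->
  (forall q i j, chart_dom c q -> P c q i j = \sum_t X t c q 0 i * Y t c q 0 j) ->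
  chart_dom c p ->
  lie_deriv_contra Z P c p i j =
  \sum_t (vbracket Z (X t) c p 0 i * Y t c p 0 j
          + X t c p 0 i * vbracket Z (Y t) c p 0 j).
Proof.
move=> vX vY PE cp; rewrite mxE.
under [RHS]eq_bigr do rewrite !mxE mulr_suml mulr_sumr -big_split.
rewrite exchange_big; apply: eq_bigr => k _.
rewrite (partial_splitting c k i j d (P c) X Y) // !PE // mulr_sumr !mulr_suml -!sumrB.
by apply: eq_bigr => t _ /=; ring.
Qed.
End KillingGradient.

(** * The bivector field of an action *)

Section Actions.
Context {R : realType} {n : nat} {M : manifold R n} {G : lieAlgebra R}.
Implicit Types (c : chart M) (p q : M) (U : set M) (i j k l : 'I_n).
Implicit Types (g P : tensor2 M) (f : M -> R) (A : G -> vfield M).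
Implicit Types (r : {biscalar lie_dual G}).

Lemma action_linear A c p i (k : R) (u v : G) : lie_action A -> chart_dom c p ->
  A (k *: u + v) c p 0 i = k * A u c p 0 i + A v c p 0 i.
Proof. by move=> [_ A_lin _] cp; rewrite A_lin // !mxE. Qed.

Lemma action0 A c p : lie_action A -> chart_dom c p -> A 0 c p = 0.
Proof.
move=> hA cp; apply/rowP => i; rewrite mxE.
by rewrite -[X in A X](addNr 0) -scaleN1r action_linear // mulN1r addNr.
Qed.

Lemma action_component A c p : lie_action A -> chart_dom c p ->
  exists xi : 'I_n -> lie_dual G, forall i u, xi i u = A u c p 0 i.
Proof.
move=> hA cp; have /choice[xi xiE] : forall i, exists a : lie_dual G,
    forall u, a u = A u c p 0 i.
  by move=> i; apply: linear_form_lie_dual => k u v; apply: action_linear.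
by exists xi.
Qed.

Lemma action_derivable A c k i u p : lie_action A -> chart_dom c p ->
  chart_derivable c k (fun q => A u c q 0 i) p.
Proof. by move=> [vA _ _]; apply: vector_field_derivable. Qed.

(** Partial derivatives at p only see a neighbourhood of p, on which the components
    of the action depend linearly on the element of the Lie algebra. *)
Lemma action_component_partial A c p : lie_action A -> chart_dom c p ->
  exists eta : 'I_n -> 'I_n -> lie_dual G,
    forall k i u, eta k i u = partial c k (fun q => A u c q 0 i) p.
Proof.
move=> hA cp; have dA k i u := action_derivable A c k i u p hA cp.
have /choice[eta etaE] : forall ki : 'I_n * 'I_n, exists a : lie_dual G,
    forall u, a u = partial c ki.1 (fun q => A u c q 0 ki.2) p.
  move=> [k i]; apply: linear_form_lie_dual => s u v /=.
  rewrite -partialZ // -partialD //; last first.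
    by apply: chart_derivableM => //; apply: derivable_cst.
  apply: (eq_partial c k setT) => //; first exact: openT.
  by move=> q cq _; apply: action_linear.
by exists (fun k i => eta (k, i)) => k i u; exact: etaE.
Qed.

Lemma action_bracket A c p u v j : lie_action A -> chart_dom c p ->
  A (lie G u v) c p 0 j =
  \sum_i (A u c p 0 i * partial c i (fun q => A v c q 0 j) p
          - A v c p 0 i * partial c i (fun q => A u c q 0 j) p).
Proof. by move=> [_ _ A_lie] cp; rewrite A_lie // mxE. Qed.

(** Shows that the bivector field depends on r alone, and not on its
    decomposition. *)
Lemma action_bivectorE A r m (a : 'M[R]_m) (u : 'I_m -> G) c p
    (xi : 'I_n -> lie_dual G) i j :
  decomposition r a u -> (forall i v, xi i v = A v c p 0 i) ->
  action_bivector A a u c p i j = r (xi i) (xi j).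
Proof.
move=> hdec xiE; rewrite hdec summxE; apply: eq_bigr => s _.
by rewrite summxE; apply: eq_bigr => t _; rewrite mxE; congr (_ * _);
  rewrite mxE /wedge2 !xiE [X in _ - X]mulrC.
Qed.

Arguments action_bivectorE {A r m a u c p xi i j}.

Lemma action_bivector_splitting A r m (a : 'M[R]_m) (u : 'I_m -> G)
    d (x y : 'I_d -> G) c p i j :
  lie_action A -> decomposition r a u ->
  (forall b b', r b b' = \sum_t b (x t) * b' (y t)) -> chart_dom c p ->
  action_bivector A a u c p i j = \sum_t A (x t) c p 0 i * A (y t) c p 0 j.
Proof.
move=> hA hdec rE cp; have [xi xiE] := action_component A c p hA cp.
rewrite (action_bivectorE hdec xiE) rE.
by apply: eq_bigr => t _; rewrite !xiE.
Qed.

Lemma action_bivector_partial A r m (a : 'M[R]_m) (u : 'I_m -> G)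
    d (x y : 'I_d -> G) c p k i j (xi : 'I_n -> lie_dual G)
    (eta : 'I_n -> 'I_n -> lie_dual G) :
  lie_action A -> decomposition r a u ->
  (forall b b', r b b' = \sum_t b (x t) * b' (y t)) -> chart_dom c p ->
  (forall i v, xi i v = A v c p 0 i) ->
  (forall k i v, eta k i v = partial c k (fun q => A v c q 0 i) p) ->
  partial c k (fun q => action_bivector A a u c q i j) p
  = r (eta k i) (xi j) + r (xi i) (eta k j).
Proof.
move=> hA hdec rE cp xiE etaE; have [vA _ _] := hA.
rewrite (partial_splitting c k i j d (action_bivector A a u c)
  (fun t => A (x t)) (fun t => A (y t))) //; last first.
  by move=> q i' j' cq; apply: action_bivector_splitting hA hdec rE cq.
rewrite big_split !rE /=; congr (_ + _); apply: eq_bigr => t _;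
  by rewrite !xiE !etaE.
Qed.

Arguments action_bivector_partial {A r m a u d x y c p k i j xi eta}.

Lemma vwedge_mulmx (X Y : vfield M) c p :
  vwedge X Y c p = (X c p)^T *m Y c p - (Y c p)^T *m X c p.
Proof.
by apply/matrixP => i j; rewrite !mxE !big_ord1 !mxE; congr (_ - _); rewrite mulrC.
Qed.

Lemma action_bivector_field A r m (a : 'M[R]_m) (u : 'I_m -> G)
    d (x y : 'I_d -> G) :
  lie_action A -> decomposition r a u ->
  (forall b b', r b b' = \sum_t b (x t) * b' (y t)) ->
  is_bivector_field (action_bivector A a u).
Proof.
move=> hA hdec rE; have [vA _ _] := hA; split.
- move=> c i j k; have oV := chart_image_open c setT openT.
  apply: (Ck_eq _ _ (fun z => \sum_t A (x t) c (chart_inv c z) 0 i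
                              * A (y t) c (chart_inv c z) 0 j)) => //.
    move=> _ [p [cp _] <-] /=; rewrite chart_mapK //.
    by rewrite (action_bivector_splitting A r m a u d x y).
  apply: (smooth_sum_mul _ d (fun t z => A (x t) c (chart_inv c z) 0 i)
     (fun t z => A (y t) c (chart_inv c z) 0 j)) => // t.
    by have [sx _] := vA (x t); apply: sx.
  by have [sy _] := vA (y t); apply: sy.
- move=> c p cp; rewrite /action_bivector raddf_sum -sumrN /=; apply: eq_bigr => s _.
  rewrite raddf_sum -sumrN /=; apply: eq_bigr => t _; rewrite -scalerN linearZ /=.
  congr (_ *: _); apply/matrixP => i j; rewrite !mxE; ring.
- move=> c e p cp ep; rewrite /action_bivector mulmx_sumr mulmx_suml.
  apply: eq_bigr => s _; rewrite mulmx_sumr mulmx_suml; apply: eq_bigr => t _.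
  rewrite -scalemxAr -scalemxAl; congr (_ *: _); rewrite !vwedge_mulmx.
  have [[_ Xs] [_ Xt]] := (vA (u s), vA (u t)); rewrite (Xs c e) // (Xt c e) //.
  by rewrite !trmx_mul mulmxBr mulmxBl !mulmxA.
Qed.

(** With T z t s the derivative of A(r xi_t)^s along A(r xi_z), each of the three
    terms of the Schouten bracket is 2 (T z s t - T z t s), and xi_s([r xi_z, r xi_t])
    is T z t s - T t z s: both cyclic sums contain the same six terms. *)
Lemma action_bivector_poisson A r m (a : 'M[R]_m) (u : 'I_m -> G)
    d (x y : 'I_d -> G) :
  lie_action A -> decomposition r a u -> is_alternating r -> cybe r ->
  (forall b b', r b b' = \sum_t b (x t) * b' (y t)) ->
  is_poisson (action_bivector A a u).
Proof.
move=> hA hdec hr hcybe rE; split; first exact: action_bivector_field hA hdec rE.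
move=> c p i j k cp; have [xi xiE] := action_component A c p hA cp.
have [eta etaE] := action_component_partial A c p hA cp.
pose T (z t : 'I_n) s := \sum_l xi l (sharp r (xi z)) * eta l s (sharp r (xi t)).
have lieE s v w : xi s (lie G v w) =
    \sum_l (xi l v * eta l s w - xi l w * eta l s v).
  rewrite xiE action_bracket //; apply: eq_bigr => l _.
  by rewrite !xiE !etaE.
have SE s t z : \sum_l (action_bivector A a u c p z l *
      partial c l (fun q => action_bivector A a u c q s t) p
    + action_bivector A a u c p z l *
      partial c l (fun q => action_bivector A a u c q s t) p)
    = 2 * (T z s t - T z t s).
  rewrite /T -sumrB mulr_sumr; apply: eq_bigr => l _.
  rewrite (action_bivectorE hdec xiE).
  rewrite (action_bivector_partial hA hdec rE cp xiE etaE).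
  rewrite (alternating_antisym r (xi z)) // (alternating_antisym r (xi s)) //.
  rewrite -!sharpE; ring.
rewrite /schouten !SE.
have := hcybe (xi i) (xi j) (xi k); rewrite !lieE !sumrB -!/(T _ _ _); lra.
Qed.

(** The divergence of P is the sum over t of (div A(x_t)) A(y_t), which vanishes
    because the fields are Killing, and of the derivatives of A(y_t) along A(x_t).
    The term with the Christoffel symbols left over from the latter contracts a
    symmetric with an antisymmetric expression. *)
Lemma action_bivector_divergence g A r m (a : 'M[R]_m) (u : 'I_m -> G)
    d (x y : 'I_d -> G) c p : is_riemannian_metric g ->
  lie_action A -> (forall v, killing g (A v)) ->
  decomposition r a u -> is_alternating r ->
  (forall b b', r b b' = \sum_t b (x t) * b' (y t)) ->
  \sum_t lie G (x t) (y t) = 0 -> chart_dom c p ->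
  divergence g (action_bivector A a u) c p = 0.
Proof.
move=> hg hA kA hdec hr rE xy0 cp; apply/rowP => j; rewrite !mxE.
have [xi xiE] := action_component A c p hA cp.
have [eta etaE] := action_component_partial A c p hA cp.
pose P := action_bivector A a u.
(* Because r is alternating, twice this sum is the j-th component of the image
   of \sum_t [x_t, y_t]. *)
have trace0 : \sum_i r (xi i) (eta i j) = 0.
  have : xi j (\sum_t lie G (x t) (y t)) = 0 by rewrite xy0 linear0.
  rewrite linear_sum /=; under eq_bigr do rewrite xiE action_bracket //.
  rewrite exchange_big /=.
  under eq_bigr => i _.
    rewrite sumrB.
    over.
  rewrite sumrB.
  have -> : \sum_i \sum_t A (x t) c p 0 i * partial c i (fun q => A (y t) c q 0 j) p
      = \sum_i r (xi i) (eta i j).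
    by apply: eq_bigr => i _; rewrite rE; apply: eq_bigr => t _; rewrite xiE etaE.
  have -> : \sum_i \sum_t A (y t) c p 0 i * partial c i (fun q => A (x t) c q 0 j) p
      = - \sum_i r (xi i) (eta i j).
    rewrite -sumrN; apply: eq_bigr => i _; rewrite -alternating_antisym // rE.
    by apply: eq_bigr => t _; rewrite xiE etaE mulrC.
  by move: (\sum_i _) => s; lra.
have PE i l : P c p i l = \sum_t A (x t) c p 0 i * A (y t) c p 0 l.
  exact: action_bivector_splitting hA hdec rE cp.
transitivity (\sum_i partial c i (fun q => P c q i j) p
   + \sum_i \sum_l christoffel g c p i l i * P c p l j
   + \sum_i \sum_l christoffel g c p i l j * P c p i l).
  by rewrite -!big_split; apply: eq_bigr => i _; rewrite /cov_deriv big_split addrA.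
rewrite [X in _ + X]sum_symmetric_antisymmetric ?addr0; last 2 first.
- by move=> i l; apply: christoffel_sym.
- move=> i l; rewrite /P !(action_bivectorE hdec xiE).
  exact: alternating_antisym.
under eq_bigr => i _.
  rewrite (action_bivector_partial hA hdec rE cp xiE etaE).
  over.
rewrite big_split /= trace0 addr0.
transitivity (\sum_t (\sum_i partial c i (fun q => A (x t) c q 0 i) p
  + \sum_i \sum_l christoffel g c p i l i * A (x t) c p 0 l) * A (y t) c p 0 j).
  under [RHS]eq_bigr do rewrite mulrDl.
  rewrite big_split; congr (_ + _).
    under [RHS]eq_bigr do rewrite mulr_suml.
    rewrite exchange_big; apply: eq_bigr => i _; rewrite rE; apply: eq_bigr => t _.
    by rewrite xiE etaE.
  under [RHS]eq_bigr do rewrite mulr_suml.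
  rewrite [RHS]exchange_big; apply: eq_bigr => i _.
  under [RHS]eq_bigr do rewrite mulr_suml.
  rewrite [RHS]exchange_big; apply: eq_bigr => l _; rewrite PE mulr_sumr.
  by apply: eq_bigr => t _; rewrite mulrA.
rewrite big1 // => t _.
by rewrite (killing_divergence_free g (A (x t))) // mul0r.
Qed.

(** The form phi(v) = A(v) f satisfies A(r phi) = - P(df) = 0 at p, so that r phi = 0
    by local freeness, and phi(r b) = - b(r phi) = 0 for every b. *)
Lemma casimir_annihilated A r m (a : 'M[R]_m) (u : 'I_m -> G) U f c p v :
  lie_action A -> locally_free A -> decomposition r a u -> is_alternating r ->
  casimir (action_bivector A a u) U f -> chart_dom c p -> U p ->
  v \in im_sharp r -> \sum_k A v c p 0 k * partial c k f p = 0.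
Proof.
move=> hA hfree hdec hr [_ Cf] cp Up /im_sharpP[b ->].
have [xi xiE] := action_component A c p hA cp.
pose phi := \sum_k partial c k f p *: xi k.
have phiE w : phi w = \sum_k A w c p 0 k * partial c k f p.
  rewrite sum_lfunE; apply: eq_bigr => k _.
  by rewrite lfunE /= xiE /GRing.scale /= mulrC.
have phi0 : A (sharp r phi) c p = 0.
  apply/rowP => j; rewrite [RHS]mxE -xiE sharpE alternating_antisym //.
  have /rowP/(_ j) := Cf c p cp Up; rewrite !mxE /phi linear_sumlz => fP0.
  rewrite -[RHS]oppr0 -[X in _ = - X]fP0; congr (- _); apply: eq_bigr => k _.
  rewrite linearZl_LR mxE (action_bivectorE hdec xiE).
  by [].
have sharp0 : sharp r phi = 0.
  apply: (hfree p) => e ep; rewrite action0 //.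
  by have [vA _ _] := hA; have [_ XE] := vA (sharp r phi); rewrite (XE c e) // phi0 mul0mx.
by rewrite -phiE sharpE alternating_antisym // -sharpE sharp0 linear0 oppr0.
Qed.

(** All the x_t and y_t lie in Im r, so that the fields A(x_t) and A(y_t) annihilate
    f near p, and commute with its gradient. *)
Lemma action_bivector_casimir g A r m (a : 'M[R]_m) (u : 'I_m -> G)
    d (x y : 'I_d -> G) U f c p : is_riemannian_metric g ->
  lie_action A -> locally_free A -> (forall v, killing g (A v)) ->
  decomposition r a u -> is_alternating r ->
  (forall b b', r b b' = \sum_t b (x t) * b' (y t)) ->
  (forall t, x t \in im_sharp r /\ y t \in im_sharp r) ->
  open U -> casimir (action_bivector A a u) U f -> chart_dom c p -> U p ->
  lie_deriv_contra (gradient g f) (action_bivector A a u) c p = 0.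
Proof.
move=> hg hA hfree kA hdec hr rE xyW oU Cf cp Up; have [vA _ _] := hA.
have comm v : v \in im_sharp r -> vbracket (gradient g f) (A v) c p = 0.
  move=> vW; have [sf _] := Cf.
  apply: (killing_gradient_commute g (A v) c U) => // q cq Uq.
  exact: casimir_annihilated hA hfree hdec hr Cf cq Uq vW.
apply/matrixP => i j.
rewrite (lie_deriv_contra_splitting _ _ d (fun t => A (x t)) (fun t => A (y t))) //.
  rewrite mxE big1 // => t _; have [xW yW] := xyW t.
  by rewrite !comm // !mxE mul0r mulr0 addr0.
by move=> q i' j' cq; apply: action_bivector_splitting hA hdec rE cq.
Qed.
End Actions.

Theorem theorem1p4 (R : realType) (n : nat) (M : manifold R n)
    (g : tensor2 M) (hg : is_riemannian_metric g)
    (G : lieAlgebra R) (r : {biscalar lie_dual G}) (hr : is_alternating r)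
    (hcybe : cybe r) (hunim : unimodular r)
    (A : G -> vfield M) (hA : lie_action A) (hfree : locally_free A)
    (hkill : forall v : G, killing g (A v))
    (m : nat) (a : 'M[R]_m) (u : 'I_m -> G) (hdec : decomposition r a u) :
  killing_poisson g (action_bivector A a u).
Proof.
have [d [x [y [xyW rE xy0]]]] := unimodular_splitting r hr hcybe hunim.
split.
- exact: action_bivector_poisson hA hdec hr hcybe rE.
- move=> c p; exact: action_bivector_divergence hg hA hkill hdec hr rE xy0.
- move=> U f oU Cf c p.
  exact: action_bivector_casimir hg hA hfree hkill hdec hr rE xyW oU Cf.
Qed.
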